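(* Let $G=(V,w,m)$ be a linear graph and let $n\in V$ with $n-1,n+1\in V$. Suppose the vertex measure is log-concave around $n$, i.e. $m(n-1)\,m(n+1)\le m(n)^2$. Then $\mathrm{CD}(K,\infty,n)$ holds with $$K=\frac{\min\{\kappa(n,n+1),\kappa(n,n-1)\}}{2},$$ where $\kappa$ denotes the (generalized) Ollivier curvature.
   Context: A weighted graph $G=(V,E,w,m)$ is a connected, undirected, simple, locally finite graph $(V,E)$ with vertex weights $m:V\to(0,\infty)$ and symmetric edge weights $w:E\to(0,\infty)$, $w(x,y)=w(y,x)$ (with $w(x,y)=0$ if $x\not\sim y$). It is a linear graph if $V=\mathbb{Z}\cap I$ for a (bounded or unbounded) interval $I\subset\mathbb{R}$ and $E=\{\{n,n+1\}: n,n+1\in V\}$. The Laplacian is $\Delta f(x)=\frac1{m(x)}\sum_{y\sim x}w(x,y)(f(y)-f(x))$ for $f:V\to\mathbb{R}$. Set $\Gamma(f,g)=\frac12(\Delta(fg)-f\Delta g-g\Delta f)$, $\Gamma(f)=\Gamma(f,f)$, and $\Gamma_2(f)=\frac12\Delta\Gamma(f)-\Gamma(f,\Delta f)$. For $K\in\mathbb{R}$, $D\in(0,\infty]$ (with $1/\infty=0$) and $x\in V$, the condition $\mathrm{CD}(K,D,x)$ means $\Gamma_2(f)(x)\ge\frac1D(\Delta f(x))^2+K\,\Gamma(f)(x)$ for all $f:V\to\mathbb{R}$. For a linear graph put $d_+(n)=w(n,n+1)/m(n)$ and $d_-(n)=w(n,n-1)/m(n)$ (equal to $0$ if $n+1\notin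 V$, respectively $n-1\notin V$). On a linear graph the generalized Ollivier curvature of the edge $\{n,n+1\}$ is given by $$\kappa(n,n+1)=\kappa(n+1,n)=d_-(n+1)-d_+(n+1)-d_-(n)+d_+(n),$$ which may be taken as its definition here. *)

(* Defs.v *)
From HB Require Import structures.
From mathcomp Require Import all_boot all_order all_algebra.
From mathcomp Require Import boolp classical_sets cardinality fsbigop.
From mathcomp Require Import reals constructive_ereal.

Set Implicit Arguments.
Unset Strict Implicit.
Unset Printing Implicit Defensive.

Import Order.TTheory GRing.Theory Num.Theory.
Local Open Scope classical_set_scope.
Local Open Scope ring_scope.

Record weighted_graph (R : realType) (V : choiceType) := WeightedGraph {
  adj : rel V;
  w : V -> V -> R;
  m : V -> R;
  adj_irr : irreflexive adj;
  adj_sym : symmetric adj;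
  adj_locally_finite : forall x, finite_set [set y | adj x y];
  adj_connected : forall x y, exists2 p : seq V, path adj x p & last x p = y;
  w_sym : forall x y, w x y = w y x;
  w_gt0 : forall x y, adj x y -> 0 < w x y;
  w_eq0 : forall x y, ~~ adj x y -> w x y = 0;
  m_gt0 : forall x, 0 < m x }.

Section Curvature_dimension.
Variables (R : realType) (V : choiceType) (G : weighted_graph R V).
Implicit Types (f g : V -> R) (x : V).

Definition laplacian f x : R :=
  (m G x)^-1 * \sum_(y \in [set y | adj G x y]) w G x y * (f y - f x).

Definition Gamma f g x : R :=
  2^-1 * (laplacian (fun z => f z * g z) x
          - f x * laplacian g x - g x * laplacian f x).

Definition Gamma2 f x : R :=
  2^-1 * laplacian (Gamma f f) x - Gamma f (laplacian f) x.

(* Meant for 0 < D <= +oo; since (+oo)^-1 = 0 in \bar R, the term in D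
   vanishes for D = +oo. *)
Definition CD (K : R) (D : \bar R) x : Prop :=
  forall f, fine (D^-1)%E * laplacian f x ^+ 2 + K * Gamma f f x
            <= Gamma2 f x.

End Curvature_dimension.

Definition int_itv (R : realType) (I : interval R) :=
  {n : int | n%:~R \in I}.

HB.instance Definition _ (R : realType) (I : interval R) :=
  SubChoice.on (int_itv I).

Section Linear_graph.
Variables (R : realType) (I : interval R).
Variable G : weighted_graph R (int_itv I).
Implicit Types x y : int_itv I.

Definition linear_graph : Prop :=
  forall x y, adj G x y = (val y == val x + 1) || (val x == val y + 1).

Definition d_plus x : R :=
  if insub (val x + 1) is Some y then w G x y / m G x else 0.

Definition d_minus x : R :=
  if insub (val x - 1) is Some y then w G x y / m G x else 0.

(* Formula for the generalized Ollivier curvature of an edge of a linear graph,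
   valid for linear_graph G and adj G x y only.  It is directed, so the two
   endpoints are first put in increasing order. *)
Definition kappa x y : R :=
  let: (a, b) := if val x < val y then (x, y) else (y, x) in
  d_minus b - d_plus b - d_minus a + d_plus a.

End Linear_graph.

(* Main.v *)
Require Import Defs.
From mathcomp Require Import all_boot all_order all_algebra.
From mathcomp Require Import reals constructive_ereal.
From mathcomp Require Import classical_sets fsbigop.
From mathcomp Require Import zify ring lra.

(** On a path, [Gamma2 f n] is a quadratic form in the increments of [f] along
    the four edges nearest to [n].  Minimising over the two outer increments
    leaves a form in the inner increments X, Y which, once K Gamma is
    subtracted, is bounded below by half of p a X^2 + 2 p q X Y + q e Y^2, where
    p = d_plus n, q = d_minus n, a = d_minus (n+1), e = d_plus (n-1).  That form
    is nonnegative as soon as p q <= a e, which is log-concavity of the vertex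
    measure, because p q / (a e) = m (n-1) m (n+1) / m n ^ 2. *)

Import Order.TTheory GRing.Theory Num.Theory.
Local Open Scope ring_scope.

Set Implicit Arguments.
Unset Strict Implicit.

Section BinaryForm.
Variables (F : realFieldType) (p q a b c e X Y U Z k : F).
Hypotheses (p_gt0 : 0 < p) (q_gt0 : 0 < q) (a_gt0 : 0 < a).
Hypotheses (b_ge0 : 0 <= b) (c_ge0 : 0 <= c).
Hypothesis pq_le_ae : p * q <= a * e.

(** Completing the square in [X], after scaling by [p * a], leaves [Y ^+ 2] with a multiple of
    [a * e - p * q]. *)
Lemma inner_form_ge0 : 0 <= p * a * X ^+ 2 + 2 * p * q * X * Y + q * e * Y ^+ 2.
Proof.
rewrite -(pmulr_rge0 _ (mulr_gt0 p_gt0 a_gt0)).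
have -> : p * a * (p * a * X ^+ 2 + 2 * p * q * X * Y + q * e * Y ^+ 2) =
  (p * a * X + p * q * Y) ^+ 2 + p * q * (a * e - p * q) * Y ^+ 2 by ring.
rewrite addr_ge0 ?sqr_ge0 // mulr_ge0 ?sqr_ge0 // mulr_ge0 ?subr_ge0 //.
by rewrite ltW ?mulr_gt0.
Qed.

(** This is the curvature inequality at n times 4, with K = [k / 2]. [X], [Y] are the increments of
    f from n to n+1 and n-1; [U], [Z] continue outward, with rates [b] = d_plus (n+1) and [c] =
    d_minus (n-1). *)
Lemma Gamma2_form_ge :
  k <= a - b - q + p -> k <= q - p - c + e ->
  k * (p * X ^+ 2 + q * Y ^+ 2) <=
  p * (a * X ^+ 2 + b * U ^+ 2 - p * X ^+ 2 - q * Y ^+ 2)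
  + q * (e * Y ^+ 2 + c * Z ^+ 2 - p * X ^+ 2 - q * Y ^+ 2)
  - 2 * (p * X * (b * U - a * X - (p * X + q * Y))
         + q * Y * (c * Z - e * Y - (p * X + q * Y))).
Proof.
rewrite -[k <= _]subr_ge0 -[k <= q - _ - _ + _]subr_ge0 => k1 k2.
(* The right side minus the left is the sum of the four products below and twice the inner form. The
   outer minimisers are [U = X] and [Z = Y]. *)
have form_ge0 := inner_form_ge0.
have := mulr_ge0 k1 (mulr_ge0 (ltW p_gt0) (sqr_ge0 X)).
have := mulr_ge0 k2 (mulr_ge0 (ltW q_gt0) (sqr_ge0 Y)).
have := mulr_ge0 (mulr_ge0 (ltW p_gt0) b_ge0) (sqr_ge0 (U - X)).
have := mulr_ge0 (mulr_ge0 (ltW q_gt0) c_ge0) (sqr_ge0 (Z - Y)).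
lra.
Qed.
End BinaryForm.

Section LinearGraph.
Variables (R : realType) (I : interval R) (G : weighted_graph R (int_itv I)).
Hypothesis G_linear : linear_graph G.
Implicit Types (f g : int_itv I -> R) (x y : int_itv I).

(* Outside the interval these stay at x, so that the increments vanish. *)
Definition succ_itv x : int_itv I := insubd x (val x + 1).
Definition pred_itv x : int_itv I := insubd x (val x - 1).

Lemma succ_itvE x y : val y = val x + 1 -> succ_itv x = y.
Proof.
by move=> yE; apply: val_inj; rewrite insubdK -?yE//; exact: valP.
Qed.

Lemma pred_itvE x y : val y = val x - 1 -> pred_itv x = y.
Proof.
by move=> yE; apply: val_inj; rewrite insubdK -?yE//; exact: valP.
Qed.

Lemma d_plusE x y : val y = val x + 1 -> d_plus G x = w G x y / m G x.
Proof. by move=> yE; rewrite /d_plus -yE valK. Qed.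

Lemma d_minusE x y : val y = val x - 1 -> d_minus G x = w G x y / m G x.
Proof. by move=> yE; rewrite /d_minus -yE valK. Qed.

Lemma w_ge0 x y : 0 <= w G x y.
Proof.
by have [/w_gt0/ltW//|/w_eq0->] := boolP (adj G x y).
Qed.

Lemma d_plus_ge0 x : 0 <= d_plus G x.
Proof.
by rewrite /d_plus; case: insub => // y; rewrite divr_ge0 ?w_ge0 ?ltW ?m_gt0.
Qed.

Lemma d_minus_ge0 x : 0 <= d_minus G x.
Proof.
by rewrite /d_minus; case: insub => // y; rewrite divr_ge0 ?w_ge0 ?ltW ?m_gt0.
Qed.

Lemma laplacianE f x : laplacian G f x =
  d_plus G x * (f (succ_itv x) - f x) + d_minus G x * (f (pred_itv x) - f x).
Proof.
(* [pmap insub] drops the integers outside [I], for which [d_plus] or [d_minus] is 0 as well. *)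
rewrite /laplacian (fsbig_fwiden (pmap insub [:: val x + 1; val x - 1])).
- rewrite /d_plus /d_minus /succ_itv /pred_itv /insubd /=.
  by case: insubP => [y _ yE|_]; case: insubP => [z _ zE|_] /=;
    rewrite ?big_cons big_nil; ring.
- move=> y xy; have {xy} : adj G x y by [].
  have -> : [set` pmap insub [:: val x + 1; val x - 1]]%classic y =
    (val y \in [:: val x + 1; val x - 1]) by rewrite -mem_pmap_sub.
  by rewrite G_linear !inE [val y == val x - 1]eq_sym subr_eq.
- by apply: pmap_sub_uniq; rewrite /= inE andbT; lia.
- by move=> y [_ /= /negP/w_eq0 ->]; exact: mul0r.
Qed.

Lemma GammaE f g x : Gamma G f g x = 2^-1 *
  (d_plus G x * ((f (succ_itv x) - f x) * (g (succ_itv x) - g x))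
   + d_minus G x * ((f (pred_itv x) - f x) * (g (pred_itv x) - g x))).
Proof. by rewrite /Gamma !laplacianE; ring. Qed.

End LinearGraph.

Theorem theorem1p3 (R : realType) (I : interval R)
    (G : weighted_graph R (int_itv I)) (n n_prev n_next : int_itv I)
    (G_linear : linear_graph G)
    (n_prevE : val n_prev = val n - 1) (n_nextE : val n_next = val n + 1)
    (m_log_concave : m G n_prev * m G n_next <= m G n ^+ 2) :
  CD G (Num.min (kappa G n n_next) (kappa G n n_prev) / 2) +oo%E n.
Proof.
move=> f; rewrite invey /= mul0r add0r.
set k := Num.min _ _.
have val_n_next : val n = val n_next - 1 by rewrite n_nextE addrK.
have val_n_prev : val n = val n_prev + 1 by rewrite n_prevE subrK.
have k_next : k <= d_minus G n_next - d_plus G n_next - d_minus G n + d_plus G n.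
  have -> : d_minus G n_next - d_plus G n_next - d_minus G n + d_plus G n
    = kappa G n n_next by rewrite /kappa n_nextE ltrDl.
  by rewrite ge_min lexx.
have k_prev : k <= d_minus G n - d_plus G n - d_minus G n_prev + d_plus G n_prev.
  (* Here [kappa] swaps its arguments, since [n_prev] is the left endpoint. *)
  have -> : d_minus G n - d_plus G n - d_minus G n_prev + d_plus G n_prev
    = kappa G n n_prev by rewrite /kappa n_prevE ltrDl.
  by rewrite ge_min lexx orbT.
have w_next : 0 < w G n n_next by rewrite w_gt0 // G_linear n_nextE eqxx.
have w_prev : 0 < w G n n_prev by rewrite w_gt0 // G_linear -val_n_prev eqxx orbT.
have d_prod : d_plus G n * d_minus G n <= d_minus G n_next * d_plus G n_prev.
  rewrite (d_plusE G n_nextE) (d_minusE G n_prevE).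
  rewrite (d_minusE G val_n_next) (d_plusE G val_n_prev).
  (* Both numerators are now the same product of edge weights, so only the vertex measures in the
     denominators are compared. *)
  rewrite (w_sym G n_next) (w_sym G n_prev) !mulf_div ler_pM2l ?mulr_gt0 //.
  by rewrite lef_pV2 ?posrE ?mulr_gt0 ?m_gt0 // mulrC.
have p_gt0 : 0 < d_plus G n by rewrite (d_plusE G n_nextE) divr_gt0 ?m_gt0.
have q_gt0 : 0 < d_minus G n by rewrite (d_minusE G n_prevE) divr_gt0 ?m_gt0.
have a_gt0 : 0 < d_minus G n_next.
  by rewrite (d_minusE G val_n_next) w_sym divr_gt0 ?m_gt0.
(* If n+2 or n-2 lies outside [I], the outer increment and its rate are both 0, so boundary vertices
   need no separate case. *)
have := Gamma2_form_ge (f n_next - f n) (f n_prev - f n)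
  (f (succ_itv n_next) - f n_next) (f (pred_itv n_prev) - f n_prev)
  p_gt0 q_gt0 a_gt0 (d_plus_ge0 G n_next) (d_minus_ge0 G n_prev)
  d_prod k_next k_prev.
rewrite /Gamma2 !(laplacianE, GammaE) //.
rewrite !(succ_itvE n_nextE, pred_itvE n_prevE, pred_itvE val_n_next,
  succ_itvE val_n_prev).
lra.
Qed.
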